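(* Let $I \subset \mathbb{R}$ be an open interval. The family of all quasi-arithmetic means $A^{[f]}$ generated by functions $f \in \mathcal{C}^1(I)$ with nowhere vanishing derivative is an interval-type set in the family of all quasi-arithmetic means on $I$.
   Context: For an interval $I\subset\mathbb{R}$ and a continuous, strictly monotone function $f \colon I \to \mathbb{R}$, the quasi-arithmetic mean generated by $f$ is the function $A^{[f]} \colon \bigcup_{n=1}^\infty I^n \to I$, $A^{[f]}(a_1,\dots,a_n) := f^{-1}\left(\frac{f(a_1)+\cdots+f(a_n)}{n}\right)$. For two such functions $f,g$ on the same interval $I$, $A^{[f]} \le A^{[g]}$ means $A^{[f]}(a) \le A^{[g]}(a)$ for all $a \in \bigcup_{n=1}^\infty I^n$. A set $\mathcal{I}$ of quasi-arithmetic means on $I$ is called an interval-type set (or interval) if, whenever $A^{[f]}, A^{[g]} \in \mathcal{I}$ and $A^{[h]}$ is a quasi-arithmetic mean on $I$ (with $h$ an arbitrary continuous, strictly monotone function on $I$) such that $A^{[f]} \le A^{[h]} \le A^{[g]}$, then $A^{[h]} \in \mathcal{I}$. $\mathcal{C}^1(I)$ denotes the continuously differentiable real functions on $I$. *)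

(* Defs.v *)
From mathcomp Require Import all_boot all_order all_algebra.
From mathcomp Require Import all_classical all_reals all_analysis.

Set Implicit Arguments.
Unset Strict Implicit.
Unset Printing Implicit Defensive.

Import Order.TTheory GRing.Theory Num.Theory.
Import numFieldNormedType.Exports.

Local Open Scope classical_set_scope.
Local Open Scope ring_scope.

(* Functions on I are represented by total functions R -> R of which only the
   values on I matter. *)

Definition strictly_monotone (R : realType) (I : set R) (f : R -> R) : Prop :=
  {in I &, {homo f : x y / x < y}} \/ {in I &, {homo f : x y /~ x < y}}.

Definition qa_generator (R : realType) (I : set R) (f : R -> R) : Prop :=
  {within I, continuous f} /\ strictly_monotone I f.

(* The union of the I^n for n >= 1, as the set of nonempty lists over I. *)
Definition words (R : realType) (I : set R) : set (seq R) :=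
  [set a | (0 < size a)%N /\ forall x, x \in a -> I x].

(* A mean is a function on the subtype [words I], so that Leibniz equality of
   means is equality on the union of the I^n only; in particular it does not
   depend on the values of the generator outside I.  [pinv I f] is the inverse
   of f restricted to I: see [qameanP] below. *)
Definition qamean (R : realType) (I : set R) (f : R -> R) : words I -> R :=
  fun a => pinv I f ((\sum_(x <- val a) f x) / (size (val a))%:R).

Definition mean_le (R : realType) (I : set R) (M N : words I -> R) : Prop :=
  forall a, M a <= N a.

Definition qameans (R : realType) (I : set R) : set (words I -> R) :=
  [set qamean f | f in qa_generator I].

Definition interval_type (R : realType) (I : set R)
    (S : set (words I -> R)) : Prop :=
  S `<=` @qameans R I /\
  forall F G H : words I -> R,
    S F -> S G -> qameans H -> mean_le F H -> mean_le H G -> S H.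

(* For I open, f^`() on I depends only on the values of f on I. *)
Definition C1 (R : realType) (I : set R) (f : R -> R) : Prop :=
  (forall x, I x -> derivable f x 1) /\ {within I, continuous f^`()%classic}.

Definition C1_qameans (R : realType) (I : set R) : set (words I -> R) :=
  [set qamean f | f in [set f | C1 I f /\ forall x, I x -> f^`()%classic x != 0]].

Lemma interval_average (R : realType) (J : set R) (f : R -> R) (a : seq R) :
  is_interval J -> (0 < size a)%N -> (forall x, x \in a -> J (f x)) ->
  J ((\sum_(x <- a) f x) / (size a)%:R).
Proof.
move=> iJ; elim: a => [//|x [|y a] IH] _ Ja.
  by rewrite big_seq1 divr1; apply: Ja; rewrite mem_head.
have Jx : J (f x) by apply: Ja; rewrite mem_head.
have {}IH : J ((\sum_(x <- y :: a) f x) / (size (y :: a))%:R).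
  by apply: IH => // z za; apply: Ja; rewrite inE za orbT.
set n := size (y :: a) in IH; set s := \sum_(x <- y :: a) f x in IH.
have n0 : 0 < n%:R :> R by rewrite ltr0n.
have n1 : 0 < n.+1%:R :> R by rewrite ltr0n.
rewrite big_cons -/s [size _]/= -/n.
have [le|/ltW le] := leP (f x) (s / n%:R).
- apply: iJ Jx IH _ _; apply/andP; split.
    by move: le; rewrite !ler_pdivlMr// -natr1 mulrDr mulr1 addrC lerD2l.
  move: le; rewrite ler_pdivrMr// -natr1 mulrDr mulr1 mulfVK ?gt_eqF//.
  by rewrite addrC lerD2l.
- apply: iJ IH Jx _ _; apply/andP; split.
    rewrite ler_pdivlMr// -natr1 mulrDr mulr1 mulfVK ?gt_eqF//.
    by rewrite addrC lerD2r.
  move: le; rewrite ler_pdivrMr// ler_pdivrMr// -natr1 mulrDr mulr1 => le.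
  by rewrite addrC lerD2r.
Qed.

Lemma qameanP (R : realType) (I : set R) (f : R -> R) (a : words I) :
  is_interval I -> qa_generator I f ->
  I (qamean f a) /\
  f (qamean f a) = (\sum_(x <- val a) f x) / (size (val a))%:R.
Proof.
move=> iI [cf _]; rewrite /qamean.
set y := _ / _.
have fIy : (f @` I) y.
  have [a0 aI] := set_valP a.
  apply: interval_average => //; last by move=> x /aI Ix; exists x.
  apply/connected_intervalP/connected_continuous_connected => //.
  exact/connected_intervalP.
split; last by rewrite pinvK// inE.
by have := @funS _ _ _ _ (pinv I f) y fIy.
Qed.

(* Main.v *)
Require Import Defs.
From mathcomp Require Import all_boot all_order all_algebra.
From mathcomp Require Import all_classical all_reals all_analysis.
From mathcomp Require Import ring lra.

Set Implicit Arguments.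
Unset Strict Implicit.
Unset Printing Implicit Defensive.

Import Order.TTheory GRing.Theory Num.Theory.
Import numFieldNormedType.Exports.

Local Open Scope classical_set_scope.
Local Open Scope ring_scope.

(* Replacing a generator by its opposite, we may assume that f, g and h are
   increasing. Then A^[f] <= A^[h] says that h is convex in the variable f, and
   A^[h] <= A^[g] that g is convex in the variable h. The two supporting lines
   at a point x of I give constants L, M > 0 with
     L (f y - f x) <= h y - h x <= (g y - g x) / M   for all y in I.
   The outer terms agree at y = x, hence have the same derivative D there, and
   h, squeezed between them, is differentiable at x with derivative D > 0. *)

(** * Order and interval preliminaries *)

Lemma incr_lt (R : realType) (I : set R) (f : R -> R) (x y : R) :
  {in I &, {homo f : x y / x < y}} -> I x -> I y -> (f x < f y) = (x < y).
Proof.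
move=> f_incr Ix Iy; have [xy|yx|->] := ltgtP x y; last by rewrite ltxx.
- by rewrite f_incr ?inE.
- by apply/negbTE; rewrite -leNgt ltW// f_incr ?inE.
Qed.

Lemma incr_le (R : realType) (I : set R) (f : R -> R) (x y : R) :
  {in I &, {homo f : x y / x < y}} -> I x -> I y -> (f x <= f y) = (x <= y).
Proof. by move=> f_incr Ix Iy; rewrite !leNgt (incr_lt f_incr). Qed.

Lemma open_itvoo_sub (R : realType) (I : set R) (x : R) : open I -> I x ->
  exists a b, [/\ a < x, x < b & forall t, a < t < b -> I t].
Proof.
move=> I_open Ix; have /nbhs_ballP[e /= e0 xeI] := open_nbhs_nbhs (conj I_open Ix).
exists (x - e), (x + e); split; [lra|lra|move=> t /andP[at_ tb]].
by apply: xeI; rewrite /ball/= ltr_norml; lra.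
Qed.

(** * From comparison of means to convexity and supporting lines *)

(** The multiples of [A / N] are spaced by less than [v - u] once [N] exceeds [A / (v - u)], so the
    first one beyond [u] falls before [v]. It provides the multiplicities of a two-letter word whose
    average must land in a given window. *)
Lemma exists_frac_between (R : realType) (A u v : R) :
  0 <= u -> u < v -> v <= A ->
  exists p q : nat, (0 < p + q)%N /\
    u * (p + q)%:R < q%:R * A < v * (p + q)%:R.
Proof.
move=> u0 uv vA; have A0 : 0 < A by lra.
set N := (Num.truncn (A / (v - u))).+1.
have AN : A < N%:R * (v - u).
  by rewrite -ltr_pdivrMr ?subr_gt0// truncnS_gt.
have t0 : 0 <= u * N%:R / A by rewrite !mulr_ge0 ?invr_ge0 ?(ltW A0).
set q := (Num.truncn (u * N%:R / A)).+1.
have uq : u * N%:R < q%:R * A by rewrite -ltr_pdivrMr// truncnS_gt.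
have qv : q%:R * A < v * N%:R.
  have /andP[+ _] := truncn_itv t0.
  rewrite ler_pdivlMr// /q -natr1 => h; lra.
have qN : (q <= N)%N.
  rewrite -(ler_nat R) -(ler_pM2r A0); have : 0 <= N%:R :> R by []; nra.
exists (N - q)%N, q; rewrite subnK//; split => //.
by rewrite uq qv.
Qed.

(* If the inequality failed at [y], it would by continuity fail on some
   [w, y[; there lies the G-mean [m] of a word made of p copies of x and q
   copies of z, whose value [H m] is at most the average of H on this word. *)
Lemma increasing_slope_le (R : realType) (I : set R) (G H : R -> R) (x y z : R) :
  is_interval I -> open I -> qa_generator I G -> qa_generator I H ->
  {in I &, {homo G : x y / x < y}} -> {in I &, {homo H : x y / x < y}} ->
  mean_le (@qamean R I G) (@qamean R I H) ->
  I x -> I z -> x < y -> y < z ->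
  (H y - H x) * (G z - G x) <= (H z - H x) * (G y - G x).
Proof.
move=> I_itv I_open qG qH G_incr H_incr GH Ix Iz xy yz.
have btw s : x <= s <= z -> I s by apply: I_itv.
have Iy : I y by apply: btw; rewrite !ltW.
rewrite leNgt; apply/negP => yE.
pose e s := (H s - H x) * (G z - G x) - (H z - H x) * (G s - G x).
have e_cont : {for y, continuous e}.
  move: qG.1 qH.1; rewrite !continuous_open_subspace// => cG cH.
  have {}cG := cG y (mem_set Iy); have {}cH := cH y (mem_set Iy).
  apply: cvgB; apply: cvgM; try exact: cvg_cst;
    by apply: cvgB => //; exact: cvg_cst.
have ey : 0 < e y by rewrite subr_gt0.
have /nbhs_ballP[d /= d0 yd] : \forall s \near y, 0 < e s.
  by exact: (cvgr_gt (e y) e_cont).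
(* Halving [d] keeps [[w, y[] inside the ball where [e] is positive; the maximum with [x] keeps [w]
   in [I]. *)
pose w := Num.max x (y - d / 2).
have xw : x <= w by rewrite le_max lexx.
have wy : w < y by rewrite gt_max xy/=; lra.
have ew s : w < s < y -> 0 < e s.
  move=> /andP[ws sy]; apply: yd; rewrite /ball/= ltr_norml.
  by move: ws; rewrite gt_max => /andP[_]; lra.
have Iw : I w by apply: btw; rewrite xw; lra.
(* These multiplicities put the average of [G] over the word strictly between [G w] and [G y]. *)
have [|||p [q [pq /andP[lo hi]]]] :=
  @exists_frac_between R (G z - G x) (G w - G x) (G y - G x).
- by rewrite subr_ge0 (incr_le G_incr).
- by rewrite ltrD2r (incr_lt G_incr).
- by rewrite lerD2r (incr_le G_incr)// ltW.
have wP : words I (nseq p x ++ nseq q z).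
  split; first by rewrite size_cat !size_nseq.
  by move=> t; rewrite mem_cat !mem_nseq => /orP[] /andP[_ /eqP ->].
pose a : words I := exist (fun s => s \in words I) _ (mem_set wP).
have avg (f : R -> R) : (\sum_(t <- val a) f t) / (size (val a))%:R =
    f x + q%:R * (f z - f x) / (p + q)%:R.
  have n0 : (p + q)%:R != 0 :> R by rewrite pnatr_eq0 -lt0n.
  rewrite /a/= size_cat !size_nseq big_cat/= !big_nseq !iter_addr_0.
  move: n0; rewrite natrD -(mulr_natr (f x)) -(mulr_natr (f z)) => n0; by field.
have [Im Gm] := qameanP a I_itv qG; have [Im' Hm] := qameanP a I_itv qH.
have Hle : H (qamean G a) <= H (qamean H a) by rewrite (incr_le H_incr).
rewrite {}Hm avg in Hle; rewrite avg in Gm.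
set m := qamean G a in Gm Hle Im.
have n0 : 0 < (p + q)%:R :> R by rewrite ltr0n.
have Gm' : (G m - G x) = q%:R * (G z - G x) / (p + q)%:R by rewrite Gm; ring.
have Hm' : (H m - H x) <= q%:R * (H z - H x) / (p + q)%:R.
  by rewrite lerBlDl.
have wm : w < m < y.
  rewrite -(incr_lt G_incr Iw)// -(incr_lt G_incr _ Iy)//.
  apply/andP; split; rewrite -(ltrD2r (- G x)) Gm'.
    by rewrite ltr_pdivlMr.
  by rewrite ltr_pdivrMr.
(* [G m] equals the average of [G] and [H m] is at most that of [H], so the point [(G m, H m)] is
   not above the chord from [x] to [z]: [e m <= 0]. *)
have := ew _ wm; apply/negP; rewrite -leNgt /e Gm' subr_le0.
have Gxz : 0 <= G z - G x by rewrite subr_ge0 (incr_le G_incr) //; lra.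
apply: le_trans (ler_wpM2r Gxz Hm') _.
by rewrite le_eqVlt; apply/orP; left; apply/eqP; ring.
Qed.

(** By convexity, each slope of [H] against [G] to the left of [x] is at most each slope to the
    right; [L] is the supremum of the left slopes. *)
Lemma increasing_support (R : realType) (I : set R) (G H : R -> R) (x : R) :
  is_interval I -> open I -> qa_generator I G -> qa_generator I H ->
  {in I &, {homo G : x y / x < y}} -> {in I &, {homo H : x y / x < y}} ->
  mean_le (@qamean R I G) (@qamean R I H) -> I x ->
  exists2 L, 0 < L & forall y, I y -> L * (G y - G x) <= H y - H x.
Proof.
move=> I_itv I_open qG qH G_incr H_incr GH Ix.
have [a [b [ax xb abI]]] := open_itvoo_sub I_open Ix.
(* Openness gives points on both sides of [x]: [w0] makes the set of left slopes nonempty and its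
   supremum positive, [z0] bounds it. *)
have [w0 [Iw0 wx0]] : exists w, I w /\ w < x.
  by exists ((a + x) / 2); split; [apply: abI|]; lra.
have [z0 [Iz0 xz0]] : exists z, I z /\ x < z.
  by exists ((x + b) / 2); split; [apply: abI|]; lra.
have G_lt s t : I s -> I t -> s < t -> 0 < G t - G s.
  by move=> Is It st; rewrite subr_gt0 (incr_lt G_incr).
pose E := [set (H x - H w) / (G x - G w) | w in [set w | I w /\ w < x]].
have E_ub z : I z -> x < z -> ubound E ((H z - H x) / (G z - G x)).
  move=> Iz xz _ [w [Iw wx] <-].
  have := increasing_slope_le I_itv I_open qG qH G_incr H_incr GH Iw Iz wx xz.
  have := G_lt _ _ Iw Ix wx; have := G_lt _ _ Ix Iz xz => xz_gt0 wx_gt0.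
  by rewrite ler_pdivrMr// mulrAC ler_pdivlMr//; lra.
have E_sup : has_ubound E by exists ((H z0 - H x) / (G z0 - G x)); exact: E_ub.
exists (sup E).
  apply: (@lt_le_trans _ _ ((H x - H w0) / (G x - G w0))).
    by rewrite divr_gt0 ?subr_gt0 ?(incr_lt G_incr) ?(incr_lt H_incr).
  by apply: ub_le_sup => //; exists w0.
move=> y Iy; have [xy|yx|->] := ltgtP x y; last by rewrite !subrr mulr0.
- rewrite -ler_pdivlMr ?G_lt//; apply: ge_sup; last exact: E_ub.
  by exists ((H x - H w0) / (G x - G w0)); exists w0.
- rewrite -lerN2 -mulrN !opprB -ler_pdivrMr ?G_lt//.
  by apply: ub_le_sup => //; exists y.
Qed.

(** * Squeezing limits and derivatives *)

(** A squeeze insensitive to which of [u] and [v] is the lower bound; below, their order changes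
    with the side of the point. *)
Lemma cvg_dist_le (R : realType) (T : Type) (F : set_system T) {FF : Filter F}
    (u v w : T -> R) (l : R) :
  (\forall t \near F, `|w t - u t| <= `|v t - u t|) ->
  u t @[t --> F] --> l -> v t @[t --> F] --> l -> w t @[t --> F] --> l.
Proof.
move=> wuv ul vl.
have c0 : `|v t - u t| @[t --> F] --> (0 : R).
  by have := cvg_norm (cvgB vl ul); rewrite subrr normr0; apply.
apply: (@squeeze_cvgr _ _ _ _ (fun t => u t - `|v t - u t|)
    (fun t => u t + `|v t - u t|)).
- by near=> t; rewrite -ler_distl; near: t.
- by rewrite -[l]subr0; apply: cvgB.
- by rewrite -[l]addr0; apply: cvgD.
Unshelve. all: by end_near. Qed.

(** The difference quotients are squeezed in opposite orders for [t > 0] and [t < 0]. Comparing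
    distances lets the factor [t^-1] come out in absolute value, with no case on its sign. *)
Lemma squeeze_is_derive (R : realType) (f g h : R -> R) (x d : R) :
  (\forall y \near x, f y <= h y <= g y) -> f x = h x -> g x = h x ->
  is_derive x 1 f d -> is_derive x 1 g d -> is_derive x 1 h d.
Proof.
move=> fhg fx gx df dg.
pose q (k : R -> R) t := t^-1 *: ((k \o shift x) (t *: 1) - k x).
have cf : q f t @[t --> 0^'] --> d by case: df => ? <-.
have cg : q g t @[t --> 0^'] --> d by case: dg => ? <-.
suff ch : q h t @[t --> 0^'] --> d.
  by apply: DeriveDef; [apply/cvg_ex; exists d|exact: cvg_lim ch].
apply: cvg_dist_le cf cg.
have tx : t + x @[t --> (0 : R)] --> x.
  by rewrite -[X in _ --> X]add0r; apply: cvgD => //; exact: cvg_cst.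
have sh : \forall t \near (0 : R)^', f (t + x) <= h (t + x) <= g (t + x).
  by apply: nbhs_dnbhs; exact: tx fhg.
near=> t.
have /andP[fh hg] : f (t + x) <= h (t + x) <= g (t + x) by near: t.
rewrite /q /= fx gx /GRing.scale/= mulr1 -!mulrBr !normrM.
apply: ler_wpM2l => //; rewrite !opprB !addrA !subrK.
rewrite !ger0_norm; lra.
Unshelve. all: by end_near. Qed.

(* Fermat's theorem for [g - f]. *)
Lemma is_derive_eq_touching (R : realType) (I : set R) (f g : R -> R) (x : R) :
  open I -> I x -> (forall y, I y -> derivable f y 1) ->
  (forall y, I y -> derivable g y 1) -> (forall y, I y -> f y <= g y) ->
  f x = g x -> 'D_1 f x = 'D_1 g x.
Proof.
move=> I_open Ix df dg fg fgx.
have [a [b [ax xb abI]]] := open_itvoo_sub I_open Ix.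
have xab : x \in `]a, b[ by rewrite in_itv/= ax xb.
have Iab t : t \in `]a, b[ -> I t by rewrite in_itv/=; apply: abI.
have [|||_ D0] := @derive1_at_min R (g - f) a b x _ _ xab.
- by rewrite ltW// (lt_trans ax).
- by move=> t /Iab It; apply: derivableB; [exact: dg|exact: df].
- by move=> t /Iab It; rewrite !fctE fgx subrr subr_ge0 fg.
by apply/eqP; rewrite eq_sym -subr_eq0 -deriveB ?D0//; [exact: dg|exact: df].
Qed.

Lemma open_near (R : realType) (I : set R) (P : R -> Prop) (x : R) :
  open I -> I x -> (forall y, I y -> P y) -> \forall y \near x, P y.
Proof.
move=> I_open Ix IP; near=> y; apply: IP; near: y.
exact: open_nbhs_nbhs.
Unshelve. all: by end_near. Qed.

(** * Reduction to increasing generators *)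

(** Both means lie in [I] and have the same image under [f], which is injective there. *)
Lemma qameanN (R : realType) (I : set R) (f : R -> R) :
  is_interval I -> qa_generator I f ->
  qa_generator I (- f) /\ @qamean R I (- f) = qamean f.
Proof.
move=> I_itv qf; have qNf : qa_generator I (- f).
  case: qf => cf mf; split; first by move=> x; apply: cvgN; exact: cf.
  case: mf => mf; [right|left] => x y Ix Iy xy; rewrite !fctE ltrN2; exact: mf.
split=> //; apply/funext => a.
have [Im fm] := qameanP a I_itv qf; have [Im' fm'] := qameanP a I_itv qNf.
have {fm' fm} : f (qamean (- f) a) = f (qamean f a).
  by apply: oppr_inj; rewrite fm -mulNr -sumrN; exact: fm'.
have [_ [] mf] := qf; set m := qamean f a in Im *; set n := qamean _ a in Im' *;
  have [nm|mn|//] := ltgtP n m => E.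
- by have := mf n m (mem_set Im') (mem_set Im) nm; rewrite E ltxx.
- by have := mf m n (mem_set Im) (mem_set Im') mn; rewrite E ltxx.
- by have := mf m n (mem_set Im) (mem_set Im') nm; rewrite E ltxx.
- by have := mf n m (mem_set Im') (mem_set Im) mn; rewrite E ltxx.
Qed.

Lemma qameans_increasing (R : realType) (I : set R) (H : words I -> R) :
  is_interval I -> qameans H ->
  exists h, [/\ qa_generator I h, {in I &, {homo h : x y / x < y}}
    & qamean h = H].
Proof.
move=> I_itv [h qh hH]; have [qNh NhH] := qameanN I_itv qh.
have [_ [h_incr|h_decr]] := qh; first by exists h.
exists (- h); split=> //; last by rewrite NhH.
by move=> x y Ix Iy xy; rewrite !fctE ltrN2; exact: h_decr.
Qed.

(** Rolle's theorem makes [f] injective on [I], and a continuous injection on an interval is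
    strictly monotone. *)
Lemma C1_qa_generator (R : realType) (I : set R) (f : R -> R) :
  is_interval I -> C1 I f -> (forall x, I x -> f^`()%classic x != 0) ->
  qa_generator I f.
Proof.
move=> I_itv [df _] f'0.
have I_Rhull : I = [set` Rhull I] by apply/is_intervalP.
have cf : {within I, continuous f}.
  rewrite I_Rhull; apply: derivable_within_continuous => x xI.
  by apply: df; rewrite I_Rhull.
have f_neq x y : I x -> I y -> x < y -> f x <> f y.
  move=> Ix Iy xy fxy.
  have btw z : x <= z <= y -> I z by apply: I_itv.
  have btwo z : z \in `]x, y[ -> I z.
    by rewrite in_itv/= => /andP[xz zy]; apply: btw; rewrite !ltW.
  have [||z /btwo Iz [_ fz0]] := Rolle xy _ _ fxy.
  - by move=> z /btwo; exact: df.
  - apply: continuous_subspaceW cf => z/=; rewrite in_itv/=; exact: btw.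
  - by have := f'0 _ Iz; rewrite derive1E fz0 eqxx.
split => //.
have : {in Rhull I &, injective f}.
  have inI z : z \in Rhull I -> I z by rewrite {2}I_Rhull.
  move=> x y /inI Ix /inI Iy fxy.
  have [xy|yx|//] := ltgtP x y; first by case: (f_neq _ _ Ix Iy xy).
  by case: (f_neq _ _ Iy Ix yx).
have {}cf : {within [set` Rhull I], continuous f} by rewrite -I_Rhull.
move=> /(itv_continuous_inj_mono cf) mf.
have inI z : z \in I -> z \in Rhull I by rewrite inE {1}I_Rhull.
by case: mf => mf; [left|right] => x y /inI Ix /inI Iy; exact: mf.
Qed.

Lemma C1_qameans_increasing (R : realType) (I : set R) (F : words I -> R) :
  is_interval I -> open I -> C1_qameans F ->
  exists f, [/\ C1 I f, qa_generator I f, {in I &, {homo f : x y / x < y}},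
    forall x, I x -> 0 < f^`()%classic x & qamean f = F].
Proof.
move=> I_itv I_open [f [C1f f'0] fF].
have qf := C1_qa_generator I_itv C1f f'0.
wlog f_incr : f C1f f'0 fF qf / {in I &, {homo f : x y / x < y}}.
  move=> IH; have [_ [f_incr|f_decr]] := qf; first exact: (IH f).
  have [df cf'] := C1f; have [qNf NfF] := qameanN I_itv qf.
  have N'E x : I x -> (- f)^`()%classic x = - f^`()%classic x.
    by move=> Ix; rewrite !derive1E deriveN//; exact: df.
  apply: (IH (- f)) => //.
  - split; first by move=> x Ix; apply: derivableN; exact: df.
    move: cf'; rewrite !continuous_open_subspace// => cf' x /set_mem Ix.
    rewrite /continuous_at N'E//.
    apply: cvg_trans (cvgN (cf' x (mem_set Ix))).
    (* [N'E] holds only on [I], so the limit is transferred through equality near [x]. *)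
    by apply: near_eq_cvg; apply: (open_near I_open Ix) => y Iy; rewrite N'E.
  - by move=> x Ix; rewrite N'E// oppr_eq0 f'0.
  - by rewrite NfF.
  - by move=> x y Ix Iy xy; rewrite !fctE ltrN2; exact: f_decr.
exists f; split=> // x Ix; rewrite lt_def f'0//=.
have II : I°%classic = I by apply/interior_id.
apply: (@incr_derive1_ge0 _ _ I); rewrite ?II//.
by move=> y /set_mem; exact: C1f.1.
Qed.

(** * Regularity of a generator between two C1 generators *)

(** Differentiating at the contact point identifies the slopes of the supporting lines: [L] is
    [D / f' x] and [M^-1] is [D / g' x]. In this form the bounds at different points can be
    compared. *)
Lemma squeezed_derive (R : realType) (I : set R) (f g h : R -> R) (x : R) :
  is_interval I -> open I ->
  qa_generator I f -> qa_generator I g -> qa_generator I h ->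
  {in I &, {homo f : x y / x < y}} -> {in I &, {homo g : x y / x < y}} ->
  {in I &, {homo h : x y / x < y}} ->
  (forall x, I x -> derivable f x 1) -> (forall x, I x -> derivable g x 1) ->
  (forall x, I x -> 0 < f^`()%classic x) ->
  (forall x, I x -> 0 < g^`()%classic x) ->
  mean_le (@qamean R I f) (qamean h) -> mean_le (@qamean R I h) (qamean g) ->
  I x ->
  exists D, [/\ 0 < D, is_derive x 1 h D & forall y, I y ->
    D / f^`()%classic x * (f y - f x) <= h y - h x <=
    D / g^`()%classic x * (g y - g x)].
Proof.
move=> I_itv I_open qf qg qh f_incr g_incr h_incr df dg f'0 g'0 fh hg Ix.
have [L L0 fL] := increasing_support I_itv I_open qf qh f_incr h_incr fh Ix.
have [M M0 gM] := increasing_support I_itv I_open qh qg h_incr g_incr hg Ix.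
pose u y := h x + L * (f y - f x); pose v y := h x + M^-1 * (g y - g x).
have ux : u x = h x by rewrite /u subrr mulr0 addr0.
have vx : v x = h x by rewrite /v subrr mulr0 addr0.
have tangent (k : R -> R) c y : derivable k y 1 ->
    is_derive y 1 (fun t => h x + c * (k t - k x)) (c * k^`()%classic y).
  move=> /derivableP dk; apply: is_derive_eq.
  by rewrite /GRing.scale/= derive1E; ring.
have du y : I y -> is_derive y 1 u (L * f^`()%classic y).
  by move=> Iy; apply/tangent/df.
have dv y : I y -> is_derive y 1 v (M^-1 * g^`()%classic y).
  by move=> Iy; apply/tangent/dg.
have uh y : I y -> u y <= h y by move=> /fL; rewrite /u; lra.
have hv y : I y -> h y <= v y.
  by move=> /gM gMy; rewrite /v -lerBlDl mulrC ler_pdivlMr// mulrC.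
(* [u <= h <= v] on [I] with equality at [x], so [u] and [v] touch there. *)
have DE : L * f^`()%classic x = M^-1 * g^`()%classic x.
  have [_ <-] := du _ Ix; have [_ <-] := dv _ Ix.
  apply: (is_derive_eq_touching I_open Ix); last by rewrite ux vx.
  - by move=> y /du[].
  - by move=> y /dv[].
  - by move=> y Iy; apply: le_trans (uh _ Iy) (hv _ Iy).
exists (L * f^`()%classic x); split.
- by rewrite mulr_gt0 ?f'0.
- apply: squeeze_is_derive ux vx (du _ Ix) _; last by rewrite DE; exact: dv.
  by apply: (open_near I_open Ix) => y Iy; rewrite uh ?hv.
- move=> y Iy; rewrite {2}DE !mulfK ?gt_eqF ?f'0 ?g'0// fL//=.
  by have := hv _ Iy; rewrite /v; lra.
Qed.

Lemma squeezed_C1 (R : realType) (I : set R) (f g h : R -> R) :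
  is_interval I -> open I ->
  qa_generator I f -> qa_generator I g -> qa_generator I h ->
  {in I &, {homo f : x y / x < y}} -> {in I &, {homo g : x y / x < y}} ->
  {in I &, {homo h : x y / x < y}} ->
  C1 I f -> C1 I g ->
  (forall x, I x -> 0 < f^`()%classic x) ->
  (forall x, I x -> 0 < g^`()%classic x) ->
  mean_le (@qamean R I f) (qamean h) -> mean_le (@qamean R I h) (qamean g) ->
  C1 I h /\ forall x, I x -> 0 < h^`()%classic x.
Proof.
move=> I_itv I_open qf qg qh f_incr g_incr h_incr [df cf'] [dg cg'] f'0 g'0 fh hg.
have D_ x : I x -> [/\ 0 < h^`()%classic x, derivable h x 1 & forall y, I y ->
    h^`()%classic x / f^`()%classic x * (f y - f x) <= h y - h x <=
    h^`()%classic x / g^`()%classic x * (g y - g x)].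
  move=> Ix; have [D [D0 [dh Dh] hB]] :=
    squeezed_derive I_itv I_open qf qg qh f_incr g_incr h_incr df dg f'0 g'0
      fh hg Ix.
  by rewrite derive1E Dh; split.
split; last by move=> x /D_[].
split; first by move=> x /D_[].
move: cf' cg'; rewrite !continuous_open_subspace// => cf' cg' x xI.
have Ix := set_mem xI; have {}cf' := cf' _ xI; have {}cg' := cg' _ xI.
have [f'x g'x] := (f'0 _ Ix, g'0 _ Ix); have [h'x _ Bx] := D_ _ Ix.
(* [r k] is [k'] rescaled to take the value [h' x] at [x]; [r f] and [r g] are thus continuous at
   [x] with the same value. *)
pose r (k : R -> R) y : R := h^`()%classic x * k^`()%classic y / k^`()%classic x.
have cr (k : R -> R) : {for x, continuous k^`()%classic} -> 0 < k^`()%classic x ->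
    r k y @[y --> x] --> h^`()%classic x.
  move=> ck k0; have := mulfK (negbT (gt_eqF k0)) (h^`()%classic x) => <-.
  apply: cvgM; last exact: cvg_cst.
  by apply: cvgM => //; exact: cvg_cst.
(* [h'/f'] is nondecreasing and [h'/g'] is nonincreasing, so that [h' y] lies
   between [h' x * f' y / f' x] and [h' x * g' y / g' x]. *)
apply: (cvg_dist_le (w := h^`()%classic)) (cr _ cf' f'x) (cr _ cg' g'x).
apply: (open_near I_open Ix) => y Iy.
have [f'y g'y] := (f'0 _ Iy, g'0 _ Iy); have [h'y _ By] := D_ _ Iy.
(* The bounds based at [x] and at [y] concern the same increment of [h] up to sign. Adding the two
   lower bounds compares [h' / f'] at [x] and [y]; the upper bounds do so for [h' / g']. *)
have /andP[fx gx] := Bx _ Iy; have /andP[fy gy] := By _ Ix.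
have rE (k : R -> R) : r k y = h^`()%classic x / k^`()%classic x * k^`()%classic y.
  by rewrite /r; ring.
have hE (k : R -> R) : k^`()%classic y != 0 ->
    h^`()%classic y = h^`()%classic y / k^`()%classic y * k^`()%classic y.
  by move=> ?; rewrite mulfVK.
clearbody r; have [xy|yx|xy] := ltgtP x y; last first.
- by rewrite !rE -xy !mulfVK ?gt_eqF// !subrr.
- have fyx : 0 < f x - f y by rewrite subr_gt0 (incr_lt f_incr).
  have gyx : 0 < g x - g y by rewrite subr_gt0 (incr_lt g_incr).
  have hf : h^`()%classic y <= r f y.
    rewrite rE [leLHS](hE f) ?gt_eqF// ler_pM2r// -(ler_pM2r fyx); lra.
  have hg' : r g y <= h^`()%classic y.
    rewrite rE [leRHS](hE g) ?gt_eqF// ler_pM2r// -(ler_pM2r gyx); lra.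
  by rewrite !ler0_norm; lra.
- have fyx : 0 < f y - f x by rewrite subr_gt0 (incr_lt f_incr).
  have gyx : 0 < g y - g x by rewrite subr_gt0 (incr_lt g_incr).
  have hf : r f y <= h^`()%classic y.
    rewrite rE [leRHS](hE f) ?gt_eqF// ler_pM2r// -(ler_pM2r fyx); lra.
  have hg' : h^`()%classic y <= r g y.
    rewrite rE [leLHS](hE g) ?gt_eqF// ler_pM2r// -(ler_pM2r gyx); lra.
  by rewrite !ger0_norm; lra.
Qed.

Theorem proposition6 (R : realType) (I : set R)
    (I_itv : is_interval I) (I_open : open I) :
  interval_type (@C1_qameans R I).
Proof.
split.
  move=> F [f [C1f f'0] fF]; exists f => //.
  exact: C1_qa_generator.
move=> F G H /(C1_qameans_increasing I_itv I_open)[f [C1f qf f_incr f'0 <-]].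
move=> /(C1_qameans_increasing I_itv I_open)[g [C1g qg g_incr g'0 <-]].
move=> /(qameans_increasing I_itv)[h [qh h_incr <-]] fh hg.
have [C1h h'0] := squeezed_C1 I_itv I_open qf qg qh f_incr g_incr h_incr
  C1f C1g f'0 g'0 fh hg.
by exists h => //; split=> // x /h'0; rewrite lt0r => /andP[].
Qed.
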